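(* Assume that $\mathrm S$ and $\mathbb U$ are compact and that $\lambda>\frac N2\operatorname{diam}(\mathrm S,\|\cdot\|_2)^2$. Let $\ell,n,m\in\mathbb N$ and define on $\mathcal P^{(\ell)}(\mathbb X_n)^K$ the dynamic programming equations $$\mathfrak C_{\ell,n,m,T}(\hat\mu^1,\dots,\hat\mu^K):=\frac1K\sum_{k=1}^KW_{2,\lambda}(\hat\mu^k,\hat\nu^k)^2,$$ $$\mathfrak C_{\ell,n,m,t}(\hat\mu^1,\dots,\hat\mu^K):=\inf_{U\in\mathbb U_m}\int_{\mathcal P^{(\ell)}(\mathbb X_n)^K}\eta^{(\ell,n,m)}(d\hat{\boldsymbol\mu}_{t+1}\mid\hat\mu^1,\dots,\hat\mu^K;U)\,\mathfrak C_{\ell,n,m,t+1}(\hat{\boldsymbol\mu}_{t+1}),\quad t\in\{0,\dots,T-1\}.$$ Then there is a finite sequence of measurable functions $\hat\gamma^*_{\ell,n,m,t}:\mathcal P^{(\ell)}(\mathbb X_n)^K\to\mathbb U_m$, $t\in\{0,\dots,T-1\}$, such that the actions $U_t^{(\ell,n,m)*}:=\hat\gamma^*_{\ell,n,m,t}(\hat\mu_t^1,\dots,\hat\mu_t^K)$ they generate along the trajectory started at $(\hat\mu_0^1,\dots,\hat\mu_0^K)$ are optimal in the sense that $$\frac1K\sum_{k=1}^KW_{2,\lambda}\big(\hat\mu_T^{k,(U_t^{(\ell,n,m)*})_t},\hat\nu^k\big)^2=\inf_{(U_t^{(m)})_t\in\mathbb U_m^T}\frac1K\sum_{k=1}^KW_{2,\lambda}\big(\hat\mu_T^{k,(U_t^{(m)})_t},\hat\nu^k\big)^2,$$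 where $\hat\mu_T^{k,\underline U}$ is the terminal state obtained from $\hat\mu_0^k$ under the control sequence $\underline U\in\mathbb U_m^T$.
   Context: Fix integers $N,K,d,d_1,d_2,T\ge1$, $\beta>0$, $\lambda>0$. Let $\emptyset\ne\mathrm S\subset\mathbb R^d$, $p_i:=i/N$, $\mathrm{PE}_N:=\{p_1,\dots,p_N\}$, $\mathbb X:=\mathrm{PE}_N\times\mathrm S$. Let $\sigma:\mathbb R^{d_1}\to\mathbb R^{d_1}$ be $1$-Lipschitz. The action space $\mathbb U$ is a nonempty subset of $\mathbb R^{d\times d_1}\times\mathbb R^{d_1\times d}\times\mathbb R^{d_1}\times\mathbb R^{d_2\times d}\times\mathbb R^{d_2\times d}\times\mathbb R^{d\times d}$ with the Euclidean (product Frobenius) norm $\|\cdot\|_{\mathbb U}$; its elements are written $U=(\mathsf W,\mathsf A,\mathsf b,\mathsf Q,\mathsf K,\mathsf V)$. $\mathcal P(\Omega)$ denotes the Borel probability measures on $\Omega$. For $\mu\in\mathcal P(\mathbb X)$, $\mu_{\mathrm S}$ is its marginal on $\mathrm S$. Define $f:\mathbb X\times\mathbb U\times\mathcal P(\mathbb X)\to\mathbb X$ by $$f((p,x),U,\mu):=\Big(p,\ \mathsf W\sigma(\mathsf Ax+\mathsf b)+\frac{\int_{\mathrm S}e^{\beta\langle\mathsf Qx,\mathsf Kz\rangle}\mathsf Vz\,\mu_{\mathrm S}(dz)}{\int_{\mathrm S}e^{\beta\langle\mathsf Qx,\mathsf Kz\rangle}\mu_{\mathrm S}(dz)}\Big);$$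 it is a standing convention that $f$ is $\mathbb X$-valued. $W_{2,\lambda}(P,Q):=\big(\inf_\pi\int(\|x-y\|_2^2+\lambda|p-q|^2)\,\pi(d(p,x),d(q,y))\big)^{1/2}$ over couplings $\pi$ of $P,Q\in\mathcal P(\mathbb X)$. $\operatorname{diam}(\mathrm S,\|\cdot\|_2):=\sup_{x,y\in\mathrm S}\|x-y\|_2$. Data: $(\mathbf x^k,\mathbf y^k)\in\mathrm S^N\times\mathrm S^N$, $k=1,\dots,K$; put $\mu_0^k:=\frac1N\sum_{i=1}^N\delta_{(p_i,x^{i,k})}$, $\nu^k:=\frac1N\sum_{i=1}^N\delta_{(p_i,y^{i,k})}$. Quantization: for each $n$, $\mathrm S_n\subset\mathrm S$ is finite with $\min_{s\in\mathrm S_n}\|x-s\|<\frac1n$ for all $x\in\mathrm S$; $\mathbb X_n:=\mathrm{PE}_N\times\mathrm S_n$; $Q^{(n)}:\mathbb X\to\mathbb X_n$, $Q^{(n)}(p,x):=(p,\operatorname{argmin}_{s\in\mathrm S_n}\|x-s\|)$ with ties broken measurably. For each $m$, $\mathbb U_m\subset\mathbb U$ is finite with $\min_{U'\in\mathbb U_m}\|U'-U\|_{\mathbb U}\le\frac1m$ for all $U\in\mathbb U$. $\mathcal P^{(\ell)}(\mathbb X_n)$ is the (finite) set of probability measures on $\mathbb X_n$ all of whose point masses are integer multiples of $1/\ell$, and $R_\ell:\mathcal P(\mathbb X_n)\to\mathcal P^{(\ell)}(\mathbb X_n)$ maps each measure to a closest element of $\mathcal P^{(\ell)}(\mathbb X_n)$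 with respect to $W_{2,\lambda}$. Put $f_n(\cdot;U,\mu):=Q^{(n)}(f(\cdot,U,\mu))$, $\Phi^{(n)}(\mu,U):=\mu\circ f_n(\cdot;U,\mu)^{-1}$ (push-forward), $\Phi^{(\ell,n,m)}(\hat\mu,U):=R_\ell(\Phi^{(n)}(\hat\mu,U))$ for $\hat\mu\in\mathcal P^{(\ell)}(\mathbb X_n)$, $U\in\mathbb U_m$, and $\eta^{(\ell,n,m)}(\cdot\mid\hat\mu^1,\dots,\hat\mu^K;U):=\delta_{(\Phi^{(\ell,n,m)}(\hat\mu^1,U),\dots,\Phi^{(\ell,n,m)}(\hat\mu^K,U))}(\cdot)$. The initial state is $\hat\mu_0^k:=R_\ell(\mu_0^k\circ(Q^{(n)})^{-1})$, the targets are $\hat\nu^k:=R_\ell(\nu^k\circ(Q^{(n)})^{-1})$, and the dynamics are $\hat\mu_{t+1}^k=\Phi^{(\ell,n,m)}(\hat\mu_t^k,U_t)$ with the same action $U_t$ for all $k$. Finite sets carry the discrete topology. *)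

(* Defs.v *)
From HB Require Import structures.
From mathcomp Require Import all_boot all_order all_algebra.
From mathcomp Require Import all_classical all_reals all_analysis.

Set Implicit Arguments.
Unset Strict Implicit.
Unset Printing Implicit Defensive.

Import Order.TTheory GRing.Theory Num.Theory.
Import numFieldNormedType.Exports.

Local Open Scope classical_set_scope.
Local Open Scope ring_scope.

(* Measurable types of the library are pointed, so a nonempty set is turned
   into a type together with the proof that it is nonempty; the base point
   plays no other role. *)
Definition sub (T : Type) (A : set T) (A0 : A !=set0) : Type := set_type A.

Section sub_instances.
Variables (T : Type) (A : set T) (A0 : A !=set0).
HB.instance Definition _ := gen_eqMixin (sub A0).
HB.instance Definition _ := gen_choiceMixin (sub A0).
HB.instance Definition _ :=
  isPointed.Build (sub A0) (exist _ (projT1 (cid A0)) (mem_set (projT2 (cid A0)))).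
End sub_instances.

(* [borel A0] carries the Borel sigma-algebra of the subspace topology of A. *)
Definition borel (T : topologicalType) (A : set T) (A0 : A !=set0) : Type :=
  @g_sigma_algebraType (sub A0) (@open (set_type A)).

Section borel_instances.
Variables (T : topologicalType) (A : set T) (A0 : A !=set0).
HB.instance Definition _ := Measurable.copy (borel A0)
  (@g_sigma_algebraType (sub A0) (@open (set_type A))).
End borel_instances.

Definition discrete (T : pointedType) : Type := T.

Section discrete_instances.
Variable T : pointedType.
HB.instance Definition _ := Pointed.copy (discrete T) T.
HB.instance Definition _ := @isMeasurable.Build default_measure_display
  (discrete T) discrete_measurable discrete_measurable0
  discrete_measurableC discrete_measurableU.
End discrete_instances.

Section from_discrete.
Context (T : pointedType) d' (T' : measurableType d') (f : T -> T').
Definition from_discrete : discrete T -> T' := f.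
HB.instance Definition _ :=
  @isMeasurableFun.Build _ _ (discrete T) T' from_discrete (fun _ _ _ => I).
End from_discrete.

Section euclidean.
Variable R : realType.

Definition fnorm2 m n (M : 'M[R]_(m, n)) : R := \sum_i \sum_j M i j ^+ 2.

(* The norm that the library puts on matrices is the sup norm; it induces the
   same topology as the Euclidean/Frobenius norm [fnorm]. *)
Definition fnorm m n (M : 'M[R]_(m, n)) : R := Num.sqrt (fnorm2 M).

Definition inner n (x y : 'cV[R]_n) : R := \sum_i x i 0 * y i 0.

Definition diam n (A : set 'cV[R]_n) : R :=
  sup [set fnorm (x - y) | x in A & y in A].

End euclidean.

Section empirical_measure.
Local Open Scope ereal_scope.
Context d (T : measurableType d) (R : realType).
Variables (N : nat) (N0 : (0 < N)%N) (x : 'I_N -> T).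

Definition empirical_fun (A : set T) : \bar R :=
  (N%:R^-1)%:E * \sum_(i < N) \d_(x i) A.

Let empirical0 : empirical_fun set0 = 0.
Proof. by rewrite /empirical_fun big1 ?mule0// => i _; rewrite measure0. Qed.

Let empirical_ge0 A : 0 <= empirical_fun A.
Proof. by rewrite /empirical_fun mule_ge0 ?lee_fin ?invr_ge0// sume_ge0. Qed.

Let empirical_sigma_additive : semi_sigma_additive empirical_fun.
Proof.
pose y k : T := x (insubd (Ordinal N0) k).
have Ni : (0 <= (N%:R^-1 : R))%R by rewrite invr_ge0.
have -> : empirical_fun =
    mscale (NngNum Ni) (msum (fun k => \d_(y k) : {measure set T -> \bar R}) N).
  apply/funext => A; rewrite /empirical_fun /mscale/= /msum; congr (_ * _).
  apply: eq_bigr => i _; rewrite /y (_ : insubd _ _ = i)//.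
  by apply/val_inj; rewrite val_insubd ltn_ord.
exact: measure_semi_sigma_additive.
Qed.

#[local] HB.instance Definition _ := isMeasure.Build _ _ _ empirical_fun
  empirical0 empirical_ge0 empirical_sigma_additive.

Let empirical_setT : empirical_fun setT = 1.
Proof.
rewrite /empirical_fun (eq_bigr (fun=> 1%:E)); last by move=> i _; rewrite diracT.
rewrite sumEFin big_const_ord iter_addr addr0 -EFinM.
by rewrite mulVf// pnatr_eq0 -lt0n.
Qed.

#[local] HB.instance Definition _ :=
  Measure_isProbability.Build _ _ _ empirical_fun empirical_setT.

Definition empirical : probability T R := empirical_fun.

End empirical_measure.

Lemma net_nonempty (T : Type) (A : set T) (A0 : A !=set0) (B : set (set_type A))
    (P : set_type A -> set_type A -> Prop) :
  (forall x, exists2 s, B s & P s x) -> B !=set0.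
Proof.
by move=> AB; have [a Aa] := A0; have [s Bs _] := AB (exist _ a (mem_set Aa)); exists s.
Qed.

Section actions.
Variables (R : realType) (d d1 d2 : nat).

(* (W, A, b, Q, K, V) *)
Definition action : Type := 'M[R]_(d, d1) * 'M[R]_(d1, d) * 'cV[R]_d1 *
  'M[R]_(d2, d) * 'M[R]_(d2, d) * 'M[R]_(d, d).

Definition action_norm (U : action) : R :=
  let: (W, A, b, Q, K, V) := U in
  Num.sqrt (fnorm2 W + fnorm2 A + fnorm2 b + fnorm2 Q + fnorm2 K + fnorm2 V).

End actions.

Section particle_space.
Variables (R : realType) (N d : nat) (N0 : (0 < N)%N).
Variables (S : set 'cV[R]_d) (S0 : S !=set0).

(* Ordinals start at 0: [pos i] is p_(i+1) = (i+1)/N. *)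
Definition pos (i : 'I_N) : R := i.+1%:R / N%:R.

Definition particle_set : set (R * 'cV[R]_d) := range pos `*` S.

Lemma mem_particle (i : 'I_N) (x : set_type S) :
  (pos i, sval x) \in particle_set.
Proof. by apply/mem_set; split=> /=; [exists i|exact: set_mem (svalP x)]. Qed.

Lemma particle_set_nonempty : particle_set !=set0.
Proof.
have [x Sx] := S0.
exists (pos (Ordinal N0), x); exact: set_mem (mem_particle _ (exist _ x (mem_set Sx))).
Qed.

Definition particle := borel particle_set_nonempty.

Definition mk_particle (i : 'I_N) (x : set_type S) : particle :=
  exist _ (pos i, sval x) (mem_particle i x).

Definition state_of (x : particle) : borel S0 :=
  exist _ (sval x).2 (mem_set (proj2 (set_mem (svalP x)))).

Let measurable_state_of : measurable_fun setT state_of.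
Proof.
apply: (@measurability _ _ particle (borel S0) setT state_of (@open (set_type S))) => //.
move=> _ [_ [V oV <-] <-]; rewrite setTI; apply: sub_sigma_algebra.
exists (snd @^-1` V) => //.
by apply: open_comp => // z _; exact: cvg_snd.
Qed.

HB.instance Definition _ :=
  isMeasurableFun.Build _ _ particle (borel S0) state_of measurable_state_of.

Definition marginal (mu : probability particle R) : probability (borel S0) R :=
  distribution mu state_of.

Definition couplings (P Q : probability particle R) :
    set (probability (particle * particle)%type R) :=
  [set pi | (forall A, measurable A -> pi (fst @^-1` A) = P A) /\
            (forall A, measurable A -> pi (snd @^-1` A) = Q A)].

Definition wcost (lambda : R) (z : particle * particle) : R :=
  fnorm ((sval z.1).2 - (sval z.2).2) ^+ 2 +
  lambda * `|(sval z.1).1 - (sval z.2).1| ^+ 2.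

Definition W2 (lambda : R) (P Q : probability particle R) : \bar R :=
  poweR (ereal_inf [set \int[pi]_z (wcost lambda z)%:E | pi in couplings P Q])%E
    2^-1.

Definition attention_map (d1 d2 : nat) (beta : R)
    (sigma : 'cV[R]_d1 -> 'cV[R]_d1) (x : particle) (U : action R d d1 d2)
    (mu : probability particle R) : R * 'cV[R]_d :=
  let: (W, A, b, Q, K, V) := U in
  let: (p, y) := sval x in
  let w (z : borel S0) := expR (beta * inner (Q *m y) (K *m sval z)) in
  (p, W *m sigma (A *m y + b) +
      (\int[marginal mu]_z w z)^-1 *:
        \col_i \int[marginal mu]_z (w z * (V *m sval z) i 0)).

Section quantized.
Variables (Sn : set (set_type S)) (Sn0 : Sn !=set0).

Definition grid_set : set particle := [set x | Sn (state_of x)].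

Lemma grid_set_nonempty : grid_set !=set0.
Proof.
have [s Sns] := Sn0; exists (mk_particle (Ordinal N0) s).
by rewrite /grid_set/=; congr Sn: Sns; exact/val_inj.
Qed.

(* Used with Sn finite, so that its Borel sigma-algebra is the full power set:
   measures on it are taken on [discrete grid]. *)
Definition grid : pointedType := sub grid_set_nonempty.

Definition grid_incl (mu : probability (discrete grid) R) :
    probability particle R :=
  distribution mu (from_discrete (fun x : grid => sval x : particle)).

Definition gridW2 (lambda : R) (mu nu : probability (discrete grid) R) : \bar R :=
  W2 lambda (grid_incl mu) (grid_incl nu).

(* q breaks the ties of the argmin; it does so measurably since Q is
   measurable. *)
Definition is_quantizer (Q : {mfun particle >-> (discrete grid)}) : Prop :=
  exists q : set_type S -> set_type S,
    (forall x, Sn (q x) /\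
       forall s, Sn s -> fnorm (sval x - sval (q x)) <= fnorm (sval x - sval s)) /\
    (forall x : particle, sval (sval (Q x)) = ((sval x).1, sval (q (state_of x)))).

(* P^(l): the point masses are integer multiples of 1/l. *)
Definition lattice_set (l : nat) : set (probability (discrete grid) R) :=
  [set mu | forall x, exists k : nat, mu [set x] = (k%:R / l%:R)%:E].

Lemma lattice_set_nonempty (l : nat) (l0 : (0 < l)%N) : lattice_set l !=set0.
Proof.
exists (dirac (point : discrete grid)) => x.
exists (if x == point then l else 0)%N.
rewrite /= diracE; case: eqVneq => [->|/eqP xp].
  by rewrite mem_set// divff// pnatr_eq0 -lt0n.
by rewrite memNset ?mul0r// => /esym.
Qed.

Definition lattice (l : nat) (l0 : (0 < l)%N) : pointedType :=
  sub (lattice_set_nonempty l0).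

Definition is_lattice_projection (lambda : R) (l : nat) (l0 : (0 < l)%N)
    (rho : probability (discrete grid) R -> lattice l0) : Prop :=
  forall mu (nu : lattice l0),
    (gridW2 lambda mu (sval (rho mu)) <= gridW2 lambda mu (sval nu))%E.

Section dynamics.
Variables (d1 d2 : nat) (UU : set (action R d d1 d2)).
Variables (Um : set (set_type UU)) (Um0 : Um !=set0).
Variables (lambda : R) (l : nat) (l0 : (0 < l)%N) (K : nat).
Variable f : particle -> set_type UU -> probability particle R -> particle.
Variable Q : {mfun particle >-> (discrete grid)}.
Variable rho : probability (discrete grid) R -> lattice l0.

Definition control : pointedType := sub Um0.

Definition states : pointedType := 'I_K -> lattice l0.

(* A measure on the grid enters f as a measure on the whole particle space. *)
Definition quantized_map (U : set_type UU) (mu : probability (discrete grid) R)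
  (x : particle) : grid := Q (f x U (grid_incl mu)).

Definition quantized_step (mu : probability (discrete grid) R)
    (U : set_type UU) : probability (discrete grid) R :=
  distribution mu
    (from_discrete (fun x : grid => quantized_map U mu (sval x) : discrete grid)).

Definition lattice_step (mu : lattice l0) (U : control) : lattice l0 :=
  rho (quantized_step (sval mu) (sval U)).

Definition step (mu : states) (U : control) : states :=
  fun k => lattice_step (mu k) U.

Definition transition (mu : states) (U : control) :
    {measure set (discrete states) -> \bar R} :=
  \d_(step mu U : discrete states).

Definition initial (x : 'I_K -> 'I_N -> set_type S) : states := fun k =>
  rho (distribution (empirical R N0 (fun i => mk_particle i (x k i))) Q).

(* State reached from mu under a list of controls, first control first. *)
Definition trajectory (mu : states) (U : seq control) : states := foldl step mu U.

Definition terminal_cost (nu mu : states) : \bar R :=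
  ((K%:R^-1)%:E *
    \sum_(k < K) gridW2 lambda (sval (mu k)) (sval (nu k)) ^+ 2)%E.

Definition dp_equations (T : nat) (nu : states) (C : nat -> states -> \bar R) :
    Prop :=
  (forall mu, C T mu = terminal_cost nu mu) /\
  (forall t mu, (t < T)%N -> C t mu =
     ereal_inf [set (\int[transition mu U]_mu' C t.+1 mu')%E
               | U in [set: control]]).

Lemma dp_equations_satisfiable (T : nat) (nu : states) :
  exists C, dp_equations T nu C.
Proof.
pose F (c : states -> \bar R) (mu : states) :=
  ereal_inf [set (\int[transition mu U]_mu' c mu')%E | U in [set: control]].
exists (fun t => iter (T - t) F (terminal_cost nu)); split=> [mu|t mu tT].
  by rewrite subnn.
by rewrite -subnSK.
Qed.

End dynamics.

End quantized.

End particle_space.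

(* Main.v *)
(* The transition kernel is a Dirac mass, so the dynamic programming equations
   read C_t(mu) = min_U C_{t+1}(step mu U), the minimum being attained because
   U_m is finite.  Choosing a minimiser at every (t, mu) gives the policy: C_t is
   nondecreasing in t along any trajectory, hence C_0 bounds every
   terminal cost from below, and it is constant along the trajectory of the
   policy, which therefore attains this bound.  The state space being discrete,
   measurability is automatic. *)

Require Import Defs.
From HB Require Import structures.
From mathcomp Require Import all_boot all_order all_algebra.
From mathcomp Require Import all_classical all_reals all_analysis.
Import Order.TTheory GRing.Theory Num.Theory.
Import numFieldNormedType.Exports.
Local Open Scope classical_set_scope.
Local Open Scope ring_scope.

Set Implicit Arguments.
Unset Strict Implicit.

Section minimum.
Local Open Scope ereal_scope.

(** Enumerating the set as a nonempty list gives a least entry, which is both a member and a lower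
    bound, hence the infimum. *)
Lemma ereal_inf_finite_mem (R : realType) (A : set (\bar R)) :
  finite_set A -> A !=set0 -> A (ereal_inf A).
Proof.
(* Splitting off the head [x] keeps the list nonempty, so the induction runs over the tail with the
   head generalised. *)
have seq_min (x : \bar R) s :
    exists2 y, y \in x :: s & forall z, z \in x :: s -> y <= z.
  elim: s x => [|x' s IHs] x.
    by exists x => [|z]; rewrite inE // => /eqP ->.
  have [y ys ymin] := IHs x'.
  have [xy|/ltW yx] := leP x y.
    exists x; first by rewrite inE eqxx.
    by move=> z; rewrite inE => /predU1P[->//|/ymin]; apply: le_trans.
  exists y; first by rewrite inE ys orbT.
  by move=> z; rewrite inE => /predU1P[->//|/ymin].
move=> /finite_seqP[[|x s] ->] [] //= _ _.
have [y ys ymin] := seq_min x s.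
suff -> : ereal_inf [set` x :: s] = y by [].
apply/eqP; rewrite eq_le; apply/andP; split.
  exact: ereal_inf_lbound.
exact: le_ereal_inf_tmp.
Qed.

Lemma ereal_inf_image_argmin (R : realType) (A : pointedType) (g : A -> \bar R) :
  finite_set [set: A] -> exists a, ereal_inf (range g) = g a.
Proof.
move=> /(finite_image g) gfin.
have /(ereal_inf_finite_mem gfin)[a _ ga] : range g !=set0.
  by exists (g point); exists point.
by exists a.
Qed.

End minimum.

Lemma finite_control (R : realType) (d d1 d2 : nat)
    (UU : set (action R d d1 d2)) (Um : set (set_type UU)) (Um0 : Um !=set0) :
  finite_set Um -> finite_set [set: control Um0].
Proof.
move=> Umfin.
have -> : [set: control Um0] = sval @^-1` Um.
  by apply/seteqP; split => // -[u uUm] _; exact: set_mem uUm.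
by apply: finite_preimage => // u v _ _; exact: val_inj.
Qed.

Section feedback.
Variables (X A : Type) (step : X -> A -> X) (policy : nat -> X -> A).

(** Open-loop record of the closed-loop policy: [n] counts the remaining steps, while the clock [t]
    advances because the policy depends on time. *)
Fixpoint feedback (t n : nat) (x : X) : seq A :=
  if n is n'.+1 then
    policy t x :: feedback t.+1 n' (step x (policy t x))
  else [::].

Lemma size_feedback t n x : size (feedback t n x) = n.
Proof. by elim: n t x => //= n IHn t x; rewrite IHn. Qed.

(** Certifies that the recorded actions really come from the policy: unrolling one step moves the
    start time and the start state together, so induction on the horizon applies. *)
Lemma nth_feedback a t n x i : (i < n)%N ->
  nth a (feedback t n x) i =
  policy (t + i)%N (foldl step x (take i (feedback t n x))).
Proof.
elim: n t x i => // n IHn t x [|i] /= lt_in; first by rewrite addn0.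
by rewrite IHn // addSnnS.
Qed.

Section verification.
Context disp (V : porderType disp).
Variables (T : nat) (C : nat -> X -> V).

(** Lower-bound half of verification: the one-step inequalities telescope, and the length condition
    keeps every step before the horizon. *)
Lemma value_le_cost :
  (forall t x a, (t < T)%N -> (C t x <= C t.+1 (step x a))%O) ->
  forall (s : seq A) t x, (t + size s = T)%N -> (C t x <= C T (foldl step x s))%O.
Proof.
move=> C_le; elim=> [|a s IHs] t x /=; first by rewrite addn0 => ->.
rewrite addnS => tT.
apply: (le_trans (C_le _ _ a _)); first by rewrite -tT ltnS leq_addr.
exact: IHs.
Qed.

(** Attainment half: along the policy the same telescoping runs with equalities. *)
Lemma cost_feedback :
  (forall t x, (t < T)%N -> C t x = C t.+1 (step x (policy t x))) ->
  forall n t x, (t + n = T)%N -> C T (foldl step x (feedback t n x)) = C t x.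
Proof.
move=> C_eq; elim=> [|n IHn] t x /=; first by rewrite addn0 => ->.
rewrite addnS => tT.
by rewrite IHn // -C_eq // -tT ltnS leq_addr.
Qed.

End verification.
End feedback.

Theorem theorem10 (R : realType) (N K d d1 d2 T : nat)
  (N0 : (0 < N)%N) (K0 : (0 < K)%N) (d0 : (0 < d)%N) (d10 : (0 < d1)%N)
  (d20 : (0 < d2)%N) (T0 : (0 < T)%N)
  (beta lambda : R) (beta0 : 0 < beta) (lambda0 : 0 < lambda)
  (S : set 'cV[R]_d) (S0 : S !=set0)
  (sigma : 'cV[R]_d1 -> 'cV[R]_d1)
  (sigma_lip : forall x y, fnorm (sigma x - sigma y) <= fnorm (x - y))
  (UU : set (action R d d1 d2)) (UU0 : UU !=set0)
  (f : particle N0 S0 -> set_type UU -> probability (particle N0 S0) R ->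
       particle N0 S0)
  (fE : forall x U mu, sval (f x U mu) = attention_map beta sigma x (sval U) mu)
  (x y : 'I_K -> 'I_N -> set_type S)
  (S_compact : compact S) (UU_compact : compact UU)
  (lambda_diam : N%:R / 2 * diam S ^+ 2 < lambda)
  (l n m : nat) (l0 : (0 < l)%N) (n0 : (0 < n)%N) (m0 : (0 < m)%N)
  (Sn : set (set_type S)) (Sn_finite : finite_set Sn)
  (Sn_net : forall z : set_type S,
     exists2 s, Sn s & fnorm (sval s - sval z) < n%:R^-1)
  (Um : set (set_type UU)) (Um_finite : finite_set Um)
  (Um_net : forall U : set_type UU,
     exists2 U', Um U' & action_norm (sval U' - sval U) <= m%:R^-1)
  (Sn0 := net_nonempty S0 Sn_net) (Um0 := net_nonempty UU0 Um_net)
  (Q : {mfun particle N0 S0 >-> discrete (grid N0 S0 Sn0)})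
  (Q_quantizer : is_quantizer Q)
  (rho : probability (discrete (grid N0 S0 Sn0)) R -> lattice N0 S0 Sn0 l0)
  (rho_projection : is_lattice_projection lambda rho)
  (mu0 := initial Q rho x) (nu := initial Q rho y)
  (C : nat -> states N0 S0 Sn0 l0 K -> \bar R)
  (C_dp : dp_equations Um0 lambda f Q rho T nu C) :
  exists gamma : 'I_T -> states N0 S0 Sn0 l0 K -> control Um0,
    (forall t, measurable_fun [set: discrete (states N0 S0 Sn0 l0 K)]
       (gamma t : discrete (states N0 S0 Sn0 l0 K) -> discrete (control Um0))) /\
    exists U : T.-tuple (control Um0),
      (forall t : 'I_T,
         tnth U t = gamma t (trajectory f Q rho mu0 (take t U))) /\
      terminal_cost lambda nu (trajectory f Q rho mu0 U) =
        ereal_inf [set terminal_cost lambda nu (trajectory f Q rho mu0 V)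
                  | V in [set: T.-tuple (control Um0)]].
Proof.
have [C_T C_t] := C_dp.
have C_inf t mu : (t < T)%N ->
    C t mu = ereal_inf (range (fun U : control Um0 => C t.+1 (step f Q rho mu U))).
  move=> tT; rewrite C_t //; congr ereal_inf; apply: eq_imagel => U _.
  (* Integrating against the Dirac transition evaluates at the successor state; on discrete states
     every integrand is measurable. *)
  by rewrite integral_dirac // diracT mul1e.
have [policy policyE] : {policy : nat -> states N0 S0 Sn0 l0 K -> control Um0 |
    forall t mu, (t < T)%N -> C t mu = C t.+1 (step f Q rho mu (policy t mu))}.
  (* One choice over pairs of time and state; the guard sits inside the existential, so the policy
     is total in time but constrained only before [T]. *)
  suff /choice[p pE] : forall tmu : nat * states N0 S0 Sn0 l0 K,
      exists U : control Um0, (tmu.1 < T)%N ->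
        C tmu.1 tmu.2 = C tmu.1.+1 (step f Q rho tmu.2 U).
    by exists (fun t mu => p (t, mu)) => t mu; exact: (pE (t, mu)).
  move=> [t mu] /=.
  have [U UE] := ereal_inf_image_argmin
    (fun U : control Um0 => C t.+1 (step f Q rho mu U)) (finite_control Um0 Um_finite).
  by exists U => /C_inf ->.
have C_le t mu (U : control Um0) : (t < T)%N -> (C t mu <= C t.+1 (step f Q rho mu U))%E.
  by move=> tT; rewrite C_inf //; apply: ereal_inf_lbound; exists U.
pose U := feedback (step f Q rho) policy 0 T mu0.
have sizeU : size U == T by rewrite size_feedback.
exists (fun t => policy t); split=> //.
exists (Tuple sizeU); split=> [t|].
  by rewrite (tnth_nth point) nth_feedback.
(* The policy's terminal cost becomes [C 0 mu0], to be compared with the infimum in both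
   directions. *)
rewrite -C_T (cost_feedback policyE) //.
apply/eqP; rewrite eq_le; apply/andP; split.
  apply: le_ereal_inf_tmp => _ [V _ <-]; rewrite -C_T.
  by apply: (value_le_cost C_le); rewrite size_tuple.
(* The policy's own action tuple is among the competitors and has cost [C 0 mu0]. *)
apply: ge_ereal_inf; exists (C 0 mu0) => //.
exists (Tuple sizeU) => //; rewrite -C_T; exact: (cost_feedback policyE).
Qed.
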